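(* Let $S\in\mathbb{R}^{\nu\times\nu}$, $L\in\mathbb{R}^{1\times\nu}$ with $(L,S)$ observable and $\sigma(S)\cap\Omega=\emptyset$, and let $\Pi\in\mathbb{R}^{n\times\nu}$ be the solution of $M\Pi S^2+D\Pi S+K\Pi=BL$. Let $\{\lambda_1,\dots,\lambda_{m_p}\}$ and $\{z_1,\dots,z_{m_z}\}$ be sets symmetric under complex conjugation (including multiplicities), both disjoint from $\Omega$ and from $\sigma(S)$, with $m_p+m_z\le\nu$. Let $Q_p\in\mathbb{R}^{m_p\times m_p}$, $Q_z\in\mathbb{R}^{m_z\times m_z}$ with $\sigma(Q_p)=\{\lambda_i\}$, $\sigma(Q_z)=\{z_j\}$, let $R_p\in\mathbb{R}^{m_p}$, $R_z\in\mathbb{R}^{m_z}$ be such that $(Q_p,R_p)$ and $(Q_z,R_z)$ are controllable, and let $C_{p0},C_{p1}\in\mathbb{R}^{1\times n}$ satisfy $C_{p0}\Pi=C_{p1}\Pi=0$. Let $\Upsilon_p\in\mathbb{R}^{m_p\times n}$ and $\Upsilon_z\in\mathbb{R}^{m_z\times n}$ be the solutions of $$Q_p^2\Upsilon_pM+Q_p\Upsilon_pD+\Upsilon_pK=R_pC_{p0}+Q_pR_pC_{p1},\qquad Q_z^2\Upsilon_zM+Q_z\Upsilon_zD+\Upsilon_zK=R_zC_0+Q_zR_zC_1,$$ and assume $\operatorname{rank}(\Upsilon_p\Pi)=m_p$, $\operatorname{rank}\Upsilon_z=\operatorname{rank}(\Upsilon_z\Pi)=m_z$, and that $z_1,\dots,z_{m_z}$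 are zeros of $W$ (counted with multiplicity), so that $\Upsilon_zB=0$. Put $\Upsilon=\begin{bmatrix}\Upsilon_p\\ \Upsilon_z\end{bmatrix}$. If a model in the family $\widehat\Sigma_G$ satisfies $H_1=C_1\Pi$ and $$\Upsilon\Pi F_2=\begin{bmatrix}\Upsilon_pM\Pi\\-\Upsilon_zM\Pi\end{bmatrix},\qquad \Upsilon\Pi F_1=\begin{bmatrix}\Upsilon_pD\Pi\\-\Upsilon_zD\Pi\end{bmatrix},\qquad \Upsilon\Pi G=\begin{bmatrix}\Upsilon_pB\\0\end{bmatrix},$$ then $\lambda_1,\dots,\lambda_{m_p}$ are poles and $z_1,\dots,z_{m_z}$ are zeros of $\widehat\Sigma_G$.
   Context: $\Sigma$ is the single-input single-output second-order system $M\ddot x+D\dot x+Kx=Bu$, $y=C_1\dot x+C_0x$, with $M,D,K\in\mathbb{R}^{n\times n}$, $B\in\mathbb{R}^{n}$, $C_0,C_1\in\mathbb{R}^{1\times n}$, transfer function $W(s)=(C_1s+C_0)(Ms^2+Ds+K)^{-1}B$; $\Omega=\{s\in\mathbb{C}:\det(Ms^2+Ds+K)=0\}$ is assumed to consist of $2n$ points counted with multiplicity; $\nu<n$. The family $\widehat\Sigma_G$ (of models matching the moments of $\Sigma$ at $\sigma(S)$) consists of the models $F_2\ddot\xi+F_1\dot\xi+F_0\xi=Gu$, $\psi=H_1\dot\xi+H_0\xi$, with free parameters $F_1,F_2\in\mathbb{R}^{\nu\times\nu}$, $G\in\mathbb{R}^{\nu}$, $H_1\in\mathbb{R}^{1\times\nu}$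 and with $F_0=GL-F_2S^2-F_1S$, $H_0=C_0\Pi+C_1\Pi S-H_1S$. It is assumed that $\det(s^2F_2+sF_1+F_0)$ is not identically zero and has $2\nu$ roots counted with multiplicity. Poles are the $s$ with $\det(s^2F_2+sF_1+F_0)=0$. A number $z\in\mathbb{C}$ is a zero of $\widehat\Sigma_G$ if $$\det\begin{bmatrix}F_2z^2+F_1z+F_0&-G\\ H_1z+H_0&0\end{bmatrix}=0.$$ *)

(* Defs.v *)
From HB Require Import structures.
From mathcomp Require Import all_boot all_order all_algebra.
From mathcomp Require Import complex reals.

Set Implicit Arguments.
Unset Strict Implicit.
Unset Printing Implicit Defensive.

Import Order.TTheory GRing.Theory Num.Theory.

Local Open Scope ring_scope.
Local Open Scope complex_scope.

(* The single-input single-output system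
     so_M x'' + so_D x' + so_K x = so_B u,   y = so_C1 x' + so_C0 x.
   The same type is used for the system to be reduced and for the reduced
   models F2 xi'' + F1 xi' + F0 xi = G u, psi = H1 xi' + H0 xi, that is, with
   (F2, F1, F0, G, H1, H0) as (so_M, so_D, so_K, so_B, so_C1, so_C0). *)
Record so_system (R : Type) (n : nat) := SoSystem {
  so_M : 'M[R]_n;
  so_D : 'M[R]_n;
  so_K : 'M[R]_n;
  so_B : 'cV[R]_n;
  so_C1 : 'rV[R]_n;
  so_C0 : 'rV[R]_n
}.

(* In the next three definitions the entries of the system are sent by f to a
   ring A containing the "variable" s: A is R[i] when s is a complex number,
   {poly R[i]} or its fraction field when s is an indeterminate. *)

(* M s^2 + D s + K *)
Definition so_pencil (R : Type) (n : nat) (A : comNzRingType) (f : R -> A)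
    (s : A) (Sig : so_system R n) : 'M[A]_n :=
  s ^+ 2 *: map_mx f (so_M Sig) + s *: map_mx f (so_D Sig)
  + map_mx f (so_K Sig).

(* C1 s + C0 *)
Definition so_output (R : Type) (n : nat) (A : comNzRingType) (f : R -> A)
    (s : A) (Sig : so_system R n) : 'rV[A]_n :=
  s *: map_mx f (so_C1 Sig) + map_mx f (so_C0 Sig).

(*  / M s^2 + D s + K   -B \
    \     C1 s + C0      0 /  *)
Definition so_rosenbrock (R : Type) (n : nat) (A : comNzRingType) (f : R -> A)
    (s : A) (Sig : so_system R n) : 'M[A]_(n + 1) :=
  block_mx (so_pencil f s Sig) (- map_mx f (so_B Sig))
           (so_output f s Sig) 0.

Section Complex.
Variable R : realType.
Implicit Types (n m : nat) (z : R[i]).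

Definition to_poly (a : R) : {poly R[i]} := (a%:C)%:P.

Definition to_ratfun (a : R) : {fraction {poly R[i]}} := tofrac (to_poly a).

(* det (M z^2 + D z + K) = 0; for the original system, this says z is in
   Omega. *)
Definition is_pole n (Sig : so_system R n) z : Prop :=
  \det (so_pencil (real_complex R) z Sig) = 0.

Definition is_zero n (Sig : so_system R n) z : Prop :=
  \det (so_rosenbrock (real_complex R) z Sig) = 0.

Definition pole_poly n (Sig : so_system R n) : {poly R[i]} :=
  \det (so_pencil to_poly 'X Sig).

Definition zero_poly n (Sig : so_system R n) : {poly R[i]} :=
  \det (so_rosenbrock to_poly 'X Sig).

(* p is not identically zero and has exactly k complex roots, counted with
   multiplicity. *)
Definition has_root_count (p : {poly R[i]}) (k : nat) : Prop :=
  p != 0 /\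
  exists rs : k.-tuple R[i], p = lead_coef p *: \prod_(z <- rs) ('X - z%:P).

(* Every element of s is a root of p, with at least the multiplicity it has in
   s; this holds of any s when p = 0. *)
Definition roots_with_mult (p : {poly R[i]}) (s : seq R[i]) : Prop :=
  \prod_(z <- s) ('X - z%:P) %| p.

(* W(s) = (C1 s + C0) (M s^2 + D s + K)^-1 B, as a rational function. *)
Definition transfer n (Sig : so_system R n) : {fraction {poly R[i]}} :=
  (so_output to_ratfun (tofrac 'X) Sig *m invmx (so_pencil to_ratfun (tofrac 'X) Sig)
   *m map_mx to_ratfun (so_B Sig)) 0 0.

(* w = ('X - z)^k p / q with q(z) <> 0: w is regular at z and vanishes there to
   order at least k. *)
Definition vanishes_to_order (w : {fraction {poly R[i]}}) z (k : nat) : Prop :=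
  exists p q : {poly R[i]},
    q.[z] != 0 /\ w = tofrac (('X - z%:P) ^+ k) * (tofrac p / tofrac q).

Definition zeros_with_mult (w : {fraction {poly R[i]}}) (s : seq R[i]) : Prop :=
  forall z, z \in s -> vanishes_to_order w z (count_mem z s).

Definition in_spectrum m (A : 'M[R]_m) z : Prop :=
  eigenvalue (map_mx (real_complex R) A) z.

(* The eigenvalues of A, counted with algebraic multiplicity, are the elements
   of s. *)
Definition spectrum_is m (A : 'M[R]_m) (s : seq R[i]) : Prop :=
  char_poly (map_mx (real_complex R) A) = \prod_(z <- s) ('X - z%:P).

Definition conj_symmetric (s : seq R[i]) : Prop :=
  perm_eq [seq conjc z | z <- s] s.

(* Kalman rank conditions: the rows of the first matrix are L, L S, ...,
   L S^(m-1), the columns of the second are B, Q B, ..., Q^(m-1) B. *)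
Definition observable m (L : 'rV[R]_m) (S : 'M[R]_m) : Prop :=
  \rank (\matrix_(i < m, j < m) (L *m S ^+ i) 0 j) = m.

Definition controllable m (Q : 'M[R]_m) (B : 'cV[R]_m) : Prop :=
  \rank (\matrix_(i < m, j < m) (Q ^+ j *m B) i 0) = m.

(* Shat belongs to the family of reduced models parametrized by F1, F2, G, H1. *)
Definition in_family n nu (Sig : so_system R n) (S : 'M[R]_nu) (L : 'rV[R]_nu)
    (Pi : 'M[R]_(n, nu)) (Shat : so_system R nu) : Prop :=
  [/\ so_K Shat = so_B Shat *m L - so_M Shat *m S ^+ 2 - so_D Shat *m S,
      so_C0 Shat = so_C0 Sig *m Pi + so_C1 Sig *m Pi *m S - so_C1 Shat *m S
    & has_root_count (pole_poly Shat) (2 * nu)].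

End Complex.

(* Main.v *)
(**
Completing the row-free matrix A to an invertible one shows that an identity
A P(s) = (s - Q) T(s) of polynomial matrices makes char_poly Q divide det P.

Poles: multiplying the family relation F0 = G L - F2 S^2 - F1 S by Yp Pi and
using the equation of Pi gives Yp Pi F0 = Yp K Pi; the Sylvester equation of Yp,
multiplied by Pi, then becomes Qp^2 Z F2 + Qp Z F1 + Z F0 = 0 with Z = Yp Pi,
so that Z (s^2 F2 + s F1 + F0) has s - Qp as a left factor.

Zeros: the same argument applies to [Yz Pi, Rz] and the Rosenbrock matrix, once
Yz B = 0 is known. With N = M s^2 + D s + K and d = det N, the Sylvester
equation of Yz gives Yz N = (s - Qz) E + Rz (C1 s + C0), hence
d Yz B = (s - Qz) E adj(N) B + d W Rz. Since d W is divisible by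
char_poly Qz = det (s - Qz), the right-hand side has s - Qz as a left factor;
as d is coprime to char_poly Qz, so has the constant Yz B, and comparing
degrees shows that it vanishes.
*)
Require Import Defs.
From HB Require Import structures.
From mathcomp Require Import all_boot all_order all_algebra.
From mathcomp Require Import complex reals.

Set Implicit Arguments.
Unset Strict Implicit.
Unset Printing Implicit Defensive.

Import Order.TTheory GRing.Theory Num.Theory.

Local Open Scope ring_scope.

Local Notation "A ^P" := (map_mx polyC A) (at level 8, format "A ^P").
Local Notation cplx := (map_mx (real_complex _)).

(** * Coprime factors, and polynomial matrices with left factor ['X - Q] *)

Lemma coprimep_prod (F : fieldType) (I : eqType) (p : {poly F}) (s : seq I)
    (q : I -> {poly F}) :
  {in s, forall i, coprimep p (q i)} -> coprimep p (\prod_(i <- s) q i).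
Proof.
move=> p_q; rewrite big_seq; apply: (big_ind (coprimep p)) => // [|a b].
  exact: coprimep1.
by rewrite coprimepMr => -> ->.
Qed.

Lemma dvdp_prod_XsubCX (F : fieldType) (p : {poly F}) (r : seq F)
    (k : F -> nat) :
  uniq r -> {in r, forall z, ('X - z%:P) ^+ k z %| p} ->
  \prod_(z <- r) ('X - z%:P) ^+ k z %| p.
Proof.
elim: r => [|z r IHr]; first by rewrite big_nil dvd1p.
rewrite cons_uniq big_cons => /andP[zNr r_uniq] p_dvd.
rewrite Gauss_dvdp; last first.
  apply/coprimep_expl/coprimep_prod => x xr; apply/coprimep_expr.
  by rewrite coprimep_XsubC root_XsubC; apply: contraNneq zNr => <-.
rewrite p_dvd ?mem_head // IHr // => x xr.
by apply: p_dvd; rewrite inE xr orbT.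
Qed.

Lemma char_poly_dvdp_det (F : fieldType) (m k : nat) (A : 'M[F]_(m, k))
    (Q : 'M[F]_m) (P : 'M[{poly F}]_k) (T : 'M[{poly F}]_(m, k)) :
  row_free A -> A^P *m P = char_poly_mx Q *m T -> char_poly Q %| \det P.
Proof.
move=> A_free; have := rank_leq_col A; rewrite (eqP A_free) => /subnKC km.
(* The column count is rewritten as [m + r], so that [r] further rows complete [A] to a square
   matrix. *)
move: (k - m)%N km => r km; case: k / km in A A_free P T *.
pose E := row_ebase A.
(* At full row rank [A] is [col_ebase A] times the top rows of [E]; so [U] is [A] stacked on the
   remaining rows of [E], and invertible as a product of invertible factors. *)
pose U := block_mx (col_ebase A) 0 0 1%:M *m E.
have U_unit : U \in unitmx.
  rewrite unitmx_mul row_ebase_unit andbT unitmxE det_ublock det1 mulr1.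
  by rewrite -unitmxE col_ebase_unit.
have U_A : U = col_mx A (dsubmx E).
  have A_E : A = col_ebase A *m usubmx E.
    rewrite -{1}(mulmx_ebase A) (eqP A_free) pid_mx_row -mulmxA -/E.
    by rewrite -{1}(vsubmxK E) mul_row_col mul1mx mul0mx addr0.
  rewrite /U -{1}(vsubmxK E) mul_block_col !mul0mx mul1mx addr0 add0r.
  by rewrite -A_E.
move=> AP; have detUP : (\det U)%:P * \det P
    = char_poly Q * \det (col_mx T ((dsubmx E)^P *m P)).
  rewrite -det_map_mx -det_mulmx U_A map_col_mx mul_col_mx AP.
  rewrite -[char_poly Q]mulr1 -(det1 {poly F} r) -(det_ublock _ 0) -det_mulmx.
  by rewrite mul_block_col !mul0mx mul1mx addr0 add0r.
have detU : \det U != 0 by rewrite -unitfE -unitmxE.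
by rewrite -(dvdpZr _ _ detU) -mul_polyC detUP dvdp_mulr.
Qed.

(** Left division by ['X - Q] leaves as remainder the value at [Q], with the powers of [Q] on the
    left; the hypothesis says that this remainder is zero. *)
Lemma pencil_char_poly_mx (F : fieldType) (m k : nat) (Q : 'M[F]_m)
    (A2 A1 A0 : 'M[F]_(m, k)) :
  Q *m Q *m A2 + Q *m A1 + A0 = 0 ->
  'X^2 *: A2^P + 'X *: A1^P + A0^P
  = char_poly_mx Q *m ('X *: A2^P + (Q *m A2 + A1)^P).
Proof.
move=> /eqP; rewrite addr_eq0 eq_sym eqr_oppLR => /eqP ->.
rewrite /char_poly_mx mulmxBl !mulmxDr !mul_scalar_mx -!scalemxAr.
rewrite raddfN /= !map_mxD !map_mxM scalerA -expr2 /= !mulmxDr scalerDr.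
by rewrite -mulmxA [X in _ = _ + X - _]addrC [in RHS]addrA addrKA.
Qed.

(** In positive degree the left side has no coefficients, so those of [u] satisfy
    [c j = Q *m c j.+1]. They vanish in large degree, hence by descent [c 0 = 0], and the constant
    term reads [v = - Q *m c 0]. *)
Lemma constant_char_poly_mx_mul_eq0 (F : fieldType) (m k : nat) (Q : 'M[F]_m)
    (v : 'M[F]_(m, k)) (u : 'M[{poly F}]_(m, k)) :
  v^P = char_poly_mx Q *m u -> v = 0.
Proof.
pose c j := map_mx (coefp j) u.
rewrite /char_poly_mx mulmxBl mul_scalar_mx => vu.
have coefQu j : map_mx (coefp j) (Q^P *m u) = Q *m c j.
  apply/matrixP=> a b; rewrite !mxE /= coef_sum; apply: eq_bigr => i _.
  by rewrite !mxE coefCM.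
have cS j : c j = Q *m c j.+1.
  rewrite -coefQu; apply/matrixP=> a b; move/matrixP/(_ a b): vu.
  rewrite !mxE => /(congr1 (coefp j.+1)) /=.
  by rewrite coefC coefB coefXM /= => /eqP; rewrite eq_sym subr_eq0 => /eqP.
have [d c0] : exists d, c d = 0.
  exists (\max_(a < m) \max_(b < k) size (u a b)).
  apply/matrixP=> a b; rewrite !mxE; apply: nth_default.
  exact: leq_trans (leq_bigmax b) (leq_bigmax a).
have c00 : c 0 = 0.
  by elim: (d) c0 => // j IHj cj; apply: IHj; rewrite cS cj mulmx0.
apply/matrixP=> a b; move/matrixP/(_ a b): vu; rewrite !mxE.
move/(congr1 (coefp 0)); rewrite /= coefC coefB coefXM /= sub0r => ->.
have /matrixP/(_ a b) := coefQu 0; rewrite c00 mulmx0 !mxE /= => ->.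
exact: oppr0.
Qed.

Lemma sylvester_mul_input_eq0 (F : fieldType) (m n : nat) (M D K : 'M[F]_n)
    (B : 'cV[F]_n) (C1 C0 : 'rV[F]_n) (Q : 'M[F]_m) (r : 'cV[F]_m)
    (Y : 'M[F]_(m, n)) :
  let N := 'X^2 *: M^P + 'X *: D^P + K^P in
  Q *m Q *m Y *m M + Q *m Y *m D + Y *m K = r *m C0 + Q *m r *m C1 ->
  coprimep (\det N) (char_poly Q) ->
  char_poly Q %| (('X *: C1^P + C0^P) *m \adj N *m B^P) 0 0 ->
  Y *m B = 0.
Proof.
move=> N Y_eq coNQ /dvdpP[p num_eq].
have /pencil_char_poly_mx :
    Q *m Q *m (Y *m M) + Q *m (Y *m D - r *m C1) + (Y *m K - r *m C0) = 0.
  rewrite mulmxBr !mulmxA [X in X + _]addrA addrACA Y_eq -opprD.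
  by rewrite [X in _ - X]addrC subrr.
set E := (X in _ = _ *m X) => facE.
have YN : Y^P *m N = char_poly_mx Q *m E + r^P *m ('X *: C1^P + C0^P).
  rewrite -facE !map_mxB !map_mxM /N !mulmxDr -!scalemxAr scalerBr /=.
  rewrite -!addrA; congr (_ + _); congr (_ + _).
  by rewrite addrCA [X in _ = _ + X]addrA -opprD addNr addr0.
(* The numerator [(C1 X + C0) adj(N) B] is [p * char_poly Q], and [char_poly Q] times [r] is
   ['X - Q] times its adjugate times [r]. *)
have dYB : \det N *: (Y *m B)^P
    = char_poly_mx Q *m (E *m \adj N *m B^P + p *: (\adj (char_poly_mx Q) *m r^P)).
  rewrite mulmxDr -scalemxAr !mulmxA mul_mx_adj mul_scalar_mx scalerA -num_eq.
  rewrite -mul_mx_scalar -mx11_scalar !mulmxA -!mulmxDl -YN.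
  by rewrite -[_ *m N *m _]mulmxA mul_mx_adj mul_mx_scalar -scalemxAl map_mxM.
(* Since [a * \det N + b * char_poly Q = 1], [Y *m B] is a combination of two left multiples of
   ['X - Q]: one from [dYB], one from the adjugate. *)
have /Bezout_eq1_coprimepP [[a b] /= ab1] := coNQ.
apply: (@constant_char_poly_mx_mul_eq0 _ _ _ Q _
  (a *: (E *m \adj N *m B^P + p *: (\adj (char_poly_mx Q) *m r^P))
   + b *: (\adj (char_poly_mx Q) *m (Y *m B)^P))).
rewrite mulmxDr -!scalemxAr -dYB mulmxA mul_mx_adj mul_scalar_mx !scalerA.
by rewrite -scalerDl -[\det (char_poly_mx Q)]/(char_poly Q) ab1 scale1r.
Qed.

(** * Second-order systems over the polynomial ring and its fraction field *)

Section Systems.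
Variable R : realType.

(** Serves both for evaluation of polynomials at a complex number and for the embedding [tofrac]
    into rational functions. *)
Lemma map_so_pencil (A A' : comNzRingType) (f : {rmorphism A -> A'})
    (g : R -> A) (h : R -> A') (s : A) (n : nat) (Sig : so_system R n) :
  (forall a, f (g a) = h a) ->
  map_mx f (so_pencil g s Sig) = so_pencil h (f s) Sig.
Proof.
move=> fg; rewrite /so_pencil !map_mxD !map_mxZ rmorphXn -!map_mx_comp.
by do ![congr (_ + _)]; rewrite ?(eq_map_mx _ fg).
Qed.

Lemma map_so_output (A A' : comNzRingType) (f : {rmorphism A -> A'})
    (g : R -> A) (h : R -> A') (s : A) (n : nat) (Sig : so_system R n) :
  (forall a, f (g a) = h a) ->
  map_mx f (so_output g s Sig) = so_output h (f s) Sig.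
Proof.
move=> fg; rewrite /so_output map_mxD map_mxZ -!map_mx_comp.
by congr (_ *: _ + _); rewrite ?(eq_map_mx _ fg).
Qed.

Lemma map_so_rosenbrock (A A' : comNzRingType) (f : {rmorphism A -> A'})
    (g : R -> A) (h : R -> A') (s : A) (n : nat) (Sig : so_system R n) :
  (forall a, f (g a) = h a) ->
  map_mx f (so_rosenbrock g s Sig) = so_rosenbrock h (f s) Sig.
Proof.
move=> fg; rewrite /so_rosenbrock map_block_mx (map_so_pencil _ _ fg).
rewrite (map_so_output _ _ fg) map_mxN -map_mx_comp (eq_map_mx _ fg).
by rewrite map_mx0.
Qed.

Lemma horner_to_poly (z : R[i]) (a : R) :
  horner_eval z (to_poly a) = real_complex R a.
Proof. by rewrite /= /to_poly /horner_eval hornerC. Qed.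

Lemma is_poleE (n : nat) (Sig : so_system R n) (z : R[i]) :
  is_pole Sig z <-> root (pole_poly Sig) z.
Proof.
rewrite /is_pole -{1}(hornerX z) -[_.[z]]/(horner_eval z 'X).
rewrite -(map_so_pencil _ _ (horner_to_poly z)) det_map_mx /root.
by split=> [/eqP|/eqP].
Qed.

Lemma is_zeroE (n : nat) (Sig : so_system R n) (z : R[i]) :
  is_zero Sig z <-> root (zero_poly Sig) z.
Proof.
rewrite /is_zero -{1}(hornerX z) -[_.[z]]/(horner_eval z 'X).
rewrite -(map_so_rosenbrock _ _ (horner_to_poly z)) det_map_mx /root.
by split=> [/eqP|/eqP].
Qed.

Lemma root_roots_with_mult (p : {poly R[i]}) (s : seq R[i]) (z : R[i]) :
  roots_with_mult p s -> z \in s -> root p z.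
Proof. by move=> /root_dvdp sp zs; apply: sp; rewrite root_prod_XsubC. Qed.

Lemma map_to_poly (m n : nat) (A : 'M[R]_(m, n)) :
  map_mx (@to_poly R) A = (cplx A)^P.
Proof. exact: map_mx_comp. Qed.

Lemma so_pencil_to_poly (n : nat) (Sig : so_system R n) :
  so_pencil (@to_poly R) 'X Sig
  = 'X^2 *: (cplx (so_M Sig))^P + 'X *: (cplx (so_D Sig))^P
    + (cplx (so_K Sig))^P.
Proof. by rewrite /so_pencil !map_to_poly. Qed.

Lemma so_output_to_poly (n : nat) (Sig : so_system R n) :
  so_output (@to_poly R) 'X Sig
  = 'X *: (cplx (so_C1 Sig))^P + (cplx (so_C0 Sig))^P.
Proof. by rewrite /so_output !map_to_poly. Qed.

(** The polynomial [det N * W], with the adjugate in place of the inverse; factors shared with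
    [pole_poly] are not cancelled. *)
Definition transfer_num (n : nat) (Sig : so_system R n) : {poly R[i]} :=
  (so_output (@to_poly R) 'X Sig *m \adj (so_pencil (@to_poly R) 'X Sig)
   *m map_mx (@to_poly R) (so_B Sig)) 0 0.

Lemma transferE (n : nat) (Sig : so_system R n) :
  pole_poly Sig != 0 ->
  tofrac (transfer_num Sig) = tofrac (pole_poly Sig) * transfer Sig.
Proof.
move=> pp0.
have tofrac_to_poly (a : R) : tofrac (to_poly a) = to_ratfun a by [].
set N := so_pencil (@to_ratfun R) (tofrac 'X) Sig.
have detN : \det N = tofrac (pole_poly Sig).
  by rewrite /N -(map_so_pencil _ _ tofrac_to_poly) det_map_mx.
have N_unit : N \in unitmx by rewrite unitmxE detN unitfE tofrac_eq0.
have -> : tofrac (transfer_num Sig)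
    = (map_mx (@tofrac _) (so_output (@to_poly R) 'X Sig
        *m \adj (so_pencil (@to_poly R) 'X Sig)
        *m map_mx (@to_poly R) (so_B Sig))) 0 0 by rewrite mxE.
rewrite !map_mxM map_mx_adj (map_so_pencil _ _ tofrac_to_poly).
rewrite (map_so_output _ _ tofrac_to_poly) -map_mx_comp.
rewrite (eq_map_mx _ tofrac_to_poly) -/N /transfer -/N /invmx N_unit.
by rewrite -scalemxAr -scalemxAl [in RHS]mxE mulrA -detN mulfV ?mul1r.
Qed.

Lemma vanishes_to_order_dvdp (n : nat) (Sig : so_system R n) (z : R[i])
    (k : nat) :
  pole_poly Sig != 0 -> vanishes_to_order (transfer Sig) z k ->
  ('X - z%:P) ^+ k %| transfer_num Sig.
Proof.
move=> pp0 [p [q [qz wE]]].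
have q0 : q != 0 by apply: contraNneq qz => ->; rewrite horner0.
rewrite -(@Gauss_dvdpl _ _ q); last first.
  by rewrite coprimep_expl // coprimep_sym coprimep_XsubC.
suff -> : transfer_num Sig * q = pole_poly Sig * p * ('X - z%:P) ^+ k.
  exact: dvdp_mull.
apply/eqP; rewrite -tofrac_eq !tofracM transferE // wE.
by rewrite -!mulrA mulVf ?tofrac_eq0 // mulr1 [tofrac p * _]mulrC.
Qed.

Lemma zeros_with_mult_dvdp (n : nat) (Sig : so_system R n) (s : seq R[i]) :
  pole_poly Sig != 0 -> zeros_with_mult (transfer Sig) s ->
  \prod_(z <- s) ('X - z%:P) %| transfer_num Sig.
Proof.
(* Grouping equal points turns the product into powers of distinct, hence coprime, linear
   factors. *)
move=> pp0 sW; rewrite -prodr_undup_exp_count dvdp_prod_XsubCX ?undup_uniq //.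
by move=> z; rewrite mem_undup => /sW; apply: vanishes_to_order_dvdp.
Qed.

Lemma row_free_cplx (m n : nat) (A : 'M[R]_(m, n)) :
  \rank A = m -> row_free (cplx A).
Proof. by move=> rA; rewrite /row_free mxrank_map rA. Qed.

Lemma char_poly_dvdp_pole_poly (m n : nat) (Sig : so_system R n)
    (Q : 'M[R]_m) (Z : 'M[R]_(m, n)) :
  \rank Z = m ->
  Q *m Q *m Z *m so_M Sig + Q *m Z *m so_D Sig + Z *m so_K Sig = 0 ->
  char_poly (cplx Q) %| pole_poly Sig.
Proof.
move=> /row_free_cplx Z_free Z_eq; rewrite /pole_poly so_pencil_to_poly.
have /pencil_char_poly_mx facZ : cplx Q *m cplx Q *m cplx (Z *m so_M Sig)
    + cplx Q *m cplx (Z *m so_D Sig) + cplx (Z *m so_K Sig) = 0.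
  by rewrite -!map_mxM -!map_mxD !mulmxA Z_eq map_mx0.
apply: (char_poly_dvdp_det Z_free); rewrite !mulmxDr -!scalemxAr.
by rewrite -!map_mxM; exact: facZ.
Qed.

(** Multiplying the Rosenbrock matrix on the left by [row_mx Z r] gives a quadratic pencil that
    vanishes at [Q] in the first block column, and [- Z *m B = 0] in the last. *)
Lemma char_poly_dvdp_zero_poly (m n : nat) (Sig : so_system R n)
    (Q : 'M[R]_m) (r : 'cV[R]_m) (Z : 'M[R]_(m, n)) :
  \rank Z = m ->
  Q *m Q *m Z *m so_M Sig + Q *m (Z *m so_D Sig + r *m so_C1 Sig)
    + (Z *m so_K Sig + r *m so_C0 Sig) = 0 ->
  Z *m so_B Sig = 0 ->
  char_poly (cplx Q) %| zero_poly Sig.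
Proof.
move=> rankZ Z_eq ZB.
(* [Z] is a right multiple of [row_mx Z r], whose rank is therefore at least [m]. *)
have Zr_free : row_free (cplx (row_mx Z r)).
  apply/row_free_cplx/eqP; rewrite eqn_leq rank_leq_row -{1}rankZ.
  have {1}-> : Z = row_mx Z r *m col_mx 1%:M 0.
    by rewrite mul_row_col mulmx1 mulmx0 addr0.
  exact: mxrankM_maxl.
have /pencil_char_poly_mx : cplx Q *m cplx Q *m cplx (Z *m so_M Sig)
    + cplx Q *m cplx (Z *m so_D Sig + r *m so_C1 Sig)
    + cplx (Z *m so_K Sig + r *m so_C0 Sig) = 0.
  by rewrite -!map_mxM -!map_mxD !mulmxA Z_eq map_mx0.
set T := (X in _ = _ *m X) => facZ.
apply: (char_poly_dvdp_det (T := row_mx T 0) Zr_free).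
rewrite /so_rosenbrock so_pencil_to_poly so_output_to_poly !map_to_poly.
rewrite mul_mx_row mulmx0 -facZ !map_row_mx mul_row_block mulmx0 addr0.
rewrite mulmxN -!map_mxM ZB !map_mx0 oppr0; congr row_mx.
rewrite !mulmxDr -!scalemxAr -!map_mxM !map_mxD scalerDr.
by rewrite addrACA; congr (_ + _); rewrite addrA.
Qed.

End Systems.

(** * Prescribed poles and zeros of the reduced model *)

Theorem corollary1 (R : realType) (n nu : nat) (nu_lt_n : (nu < n)%N)
    (M D K : 'M[R]_n) (B : 'cV[R]_n) (C0 C1 : 'rV[R]_n)
    (Omega_count : has_root_count (pole_poly (SoSystem M D K B C1 C0)) (2 * n))
    (S : 'M[R]_nu) (L : 'rV[R]_nu)
    (obsLS : observable L S)
    (S_Omega : forall z : R[i],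
       in_spectrum S z -> ~ is_pole (SoSystem M D K B C1 C0) z)
    (Pi : 'M[R]_(n, nu))
    (Pi_eq : M *m Pi *m S ^+ 2 + D *m Pi *m S + K *m Pi = B *m L)
    (mp mz : nat) (lam : mp.-tuple R[i]) (zs : mz.-tuple R[i])
    (lam_conj : conj_symmetric lam)
    (zs_conj : conj_symmetric zs)
    (lam_Omega : forall z : R[i],
       z \in lam -> ~ is_pole (SoSystem M D K B C1 C0) z)
    (zs_Omega : forall z : R[i],
       z \in zs -> ~ is_pole (SoSystem M D K B C1 C0) z)
    (lam_S : forall z : R[i], z \in lam -> ~ in_spectrum S z)
    (zs_S : forall z : R[i], z \in zs -> ~ in_spectrum S z)
    (m_le : (mp + mz <= nu)%N)
    (Qp : 'M[R]_mp) (Qz : 'M[R]_mz)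
    (Qp_spec : spectrum_is Qp lam)
    (Qz_spec : spectrum_is Qz zs)
    (Rp : 'cV[R]_mp) (Rz : 'cV[R]_mz)
    (ctrlp : controllable Qp Rp)
    (ctrlz : controllable Qz Rz)
    (Cp0 Cp1 : 'rV[R]_n)
    (Cp0_Pi : Cp0 *m Pi = 0)
    (Cp1_Pi : Cp1 *m Pi = 0)
    (Yp : 'M[R]_(mp, n)) (Yz : 'M[R]_(mz, n))
    (Yp_eq : Qp ^+ 2 *m Yp *m M + Qp *m Yp *m D + Yp *m K
             = Rp *m Cp0 + Qp *m Rp *m Cp1)
    (Yz_eq : Qz ^+ 2 *m Yz *m M + Qz *m Yz *m D + Yz *m K
             = Rz *m C0 + Qz *m Rz *m C1)
    (rank_YpPi : \rank (Yp *m Pi) = mp)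
    (rank_Yz : \rank Yz = mz)
    (rank_YzPi : \rank (Yz *m Pi) = mz)
    (zs_zeros : zeros_with_mult (transfer (SoSystem M D K B C1 C0)) zs)
    (F2 F1 F0 : 'M[R]_nu) (G : 'cV[R]_nu) (H1 H0 : 'rV[R]_nu)
    (family : in_family (SoSystem M D K B C1 C0) S L Pi
                        (SoSystem F2 F1 F0 G H1 H0))
    (H1_eq : H1 = C1 *m Pi)
    (F2_eq : col_mx Yp Yz *m Pi *m F2
             = col_mx (Yp *m M *m Pi) (- (Yz *m M *m Pi)))
    (F1_eq : col_mx Yp Yz *m Pi *m F1
             = col_mx (Yp *m D *m Pi) (- (Yz *m D *m Pi)))
    (G_eq : col_mx Yp Yz *m Pi *m G = col_mx (Yp *m B) 0) :
  [/\ forall z : R[i], z \in lam -> is_pole (SoSystem F2 F1 F0 G H1 H0) z,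
      forall z : R[i], z \in zs -> is_zero (SoSystem F2 F1 F0 G H1 H0) z,
      roots_with_mult (pole_poly (SoSystem F2 F1 F0 G H1 H0)) lam
    & roots_with_mult (zero_poly (SoSystem F2 F1 F0 G H1 H0)) zs].
Proof.
have [F0_eq H0_eq _] : in_family _ _ _ _ _ := family.
rewrite /= in F0_eq H0_eq.
move: F2_eq F1_eq G_eq; rewrite !mul_col_mx.
move=> /eq_col_mx[F2p F2z] /eq_col_mx[F1p F1z] /eq_col_mx[Gp Gz].
rewrite !expr2 -!mulmxE in Pi_eq Yp_eq Yz_eq F0_eq.
(* This gives [K *m Pi] the shape of [F0], with [B], [M *m Pi], [D *m Pi] in place of [G], [F2],
   [F1]. *)
have KPi : K *m Pi = B *m L - M *m Pi *m (S *m S) - D *m Pi *m S.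
  by rewrite -Pi_eq -[RHS]addrA -opprD [X in _ = X - _]addrC addrK.
have F0p : Yp *m Pi *m F0 = Yp *m K *m Pi.
  by rewrite F0_eq -[in RHS]mulmxA KPi !mulmxBr !mulmxA Gp F2p F1p.
have lam_poles : roots_with_mult (pole_poly (SoSystem F2 F1 F0 G H1 H0)) lam.
  rewrite /roots_with_mult -Qp_spec.
  apply: (char_poly_dvdp_pole_poly rank_YpPi) => /=.
  (* What remains is the Sylvester equation of [Yp] times [Pi], whose right side is killed by
     [Cp0_Pi] and [Cp1_Pi]. *)
  rewrite -[Qp *m Qp *m _ *m F2]mulmxA -[Qp *m _ *m F1]mulmxA F0p F2p F1p.
  rewrite !mulmxA -!mulmxDl Yp_eq mulmxDl -!mulmxA Cp0_Pi Cp1_Pi.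
  by rewrite !mulmx0 addr0.
have pp0 : pole_poly (SoSystem M D K B C1 C0) != 0 by case: Omega_count.
have YzB : Yz *m B = 0.
  apply/eqP; rewrite -(map_mx_eq0 (real_complex R)) map_mxM; apply/eqP.
  apply: (@sylvester_mul_input_eq0 _ _ _ (cplx M) (cplx D) (cplx K) _
    (cplx C1) (cplx C0) (cplx Qz) (cplx Rz)).
  - by rewrite -!map_mxM -!map_mxD Yz_eq.
  (* The roots of [char_poly Qz] are the [zs], none of which lies in Omega. *)
  - rewrite -(so_pencil_to_poly (SoSystem M D K B C1 C0)) Qz_spec.
    apply: coprimep_prod => z /zs_Omega zN.
    by rewrite coprimep_XsubC; apply/negP => /is_poleE.
  - rewrite -(so_pencil_to_poly (SoSystem M D K B C1 C0)) Qz_spec.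
    rewrite -(so_output_to_poly (SoSystem M D K B C1 C0)) -map_to_poly.
    exact: zeros_with_mult_dvdp.
(* The [L] terms vanish on both sides, by [Gz] and [YzB]; the signs in [F2z] and [F1z] then carry
   over to [F0]. *)
have F0z : Yz *m Pi *m F0 = - (Yz *m K *m Pi).
  rewrite F0_eq -[in RHS]mulmxA KPi !mulmxBr !mulmxA Gz F2z F1z YzB.
  by rewrite !mul0mx !sub0r !mulNmx !opprD !opprK.
(* The choice of [H1] cancels the two terms in [S]. *)
have H0E : H0 = C0 *m Pi by rewrite H0_eq H1_eq addrK.
have zs_mult : roots_with_mult (zero_poly (SoSystem F2 F1 F0 G H1 H0)) zs.
  rewrite /roots_with_mult -Qz_spec.
  apply: (@char_poly_dvdp_zero_poly _ _ _ _ _ Rz _ rank_YzPi) => //=.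
  (* The minus signs produce the negated left side of the Sylvester equation of [Yz], times [Pi];
     the [Rz] terms supply its right side. *)
  rewrite -[Qz *m Qz *m _ *m F2]mulmxA F0z F2z F1z H0E H1_eq.
  rewrite mulmxDr !mulmxN !mulmxA.
  rewrite [X in X + _]addrA addrACA -!opprD -!mulmxDl.
  by rewrite Yz_eq [Rz *m C0 + _]addrC addNr.
split=> // z z_in.
  by apply/is_poleE/(root_roots_with_mult lam_poles).
by apply/is_zeroE/(root_roots_with_mult zs_mult).
Qed.
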